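(* Let $k\ge2$ and $n$ be integers with $k$ even and $n\ge\frac{9}{32}k^2+\frac14k+1$. Then \[{\rm bal}(n,P_k)=\begin{cases}\left(\frac{k-2}{4}\right)n-\frac{k^2}{32}+\frac18, & \text{for } k\equiv2\pmod 4,\\[1ex] \left(\frac{k-4}{4}\right)n-\frac{k^2}{32}+\frac k8+1, & \text{for } k\equiv0\pmod4,\end{cases}\] and ${\rm Bal}(n,P_k)$ contains only one graph, namely the complete $\left(\frac{k-2}{4},\,n-\frac{k-2}{4}\right)$-split graph if $k\equiv2\pmod4$, and the complete $\left(\frac{k-4}{4},\,n-\frac{k-4}{4}\right)$-split graph plus one edge if $k\equiv0\pmod4$.
   Context: $P_k$ is the path with $k$ edges (and $k+1$ vertices). A complete $(p,q)$-split graph is a graph whose vertex set has a partition $X\cup Y$ with $|X|=p$, $|Y|=q$, $X$ inducing a complete graph $K_p$, $Y$ independent, and all edges between $X$ and $Y$ present (for $p=0$ it is the edgeless graph on $q$ vertices). ''Plus one edge'' means that a single edge joining two vertices of $Y$ is added. A $2$-coloring $E(K_n)=E(R)\cup E(B)$ is a partition of the edges of $K_n$ into red and blue edges, forming the spanning subgraphs $R$ and $B$; $e(\cdot)$ denotes number of edges. For a graph $G$ with $e(G)$ even, a balanced copy of $G$ is a (not necessarily induced) subgraph of $K_n$ isomorphic to $G$ with exactly $e(G)/2$ red and $e(G)/2$ blue edges. ${\rm bal}(n,G)$ is the minimum non-negative integer $s$ such that every $2$-coloring $E(K_n)=E(R)\cup E(B)$ with $\min\{e(R),e(B)\}>s$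 contains a balanced copy of $G$. ${\rm Bal}(n,G)$ is the family (up to isomorphism) of $n$-vertex graphs with exactly ${\rm bal}(n,G)$ edges such that a coloring $E(K_n)=E(R)\cup E(B)$ with $\min\{e(R),e(B)\}={\rm bal}(n,G)$ contains no balanced copy of $G$ if and only if $R$ or $B$ is isomorphic to some $H\in{\rm Bal}(n,G)$. *)

(* Defs.v *)
From mathcomp Require Import all_boot all_order all_algebra.

Set Implicit Arguments.
Unset Strict Implicit.
Unset Printing Implicit Defensive.

(* A simple graph on the vertex type V is given by its set of edges, each edge *)
(* being a set of two vertices; vertices of V in no edge are isolated.         *)
Definition complete (V : finType) : {set {set V}} := [set e : {set V} | #|e| == 2].

Definition is_graph (V : finType) (E : {set {set V}}) : bool :=
  E \subset complete V.

Definition map_edges (V W : finType) (f : V -> W) (E : {set {set V}}) :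
  {set {set W}} := [set f @: e | e : {set V} in E].

Definition graph_iso (V W : finType) (E : {set {set V}}) (F : {set {set W}}) :
  Prop := exists2 f : V -> W, bijective f & map_edges f E = F.

Definition path_graph (k : nat) : {set {set 'I_k.+1}} :=
  [set [set inord i; inord i.+1] | i : 'I_k].

Definition split_edges (V : finType) (X Y : {set V}) : {set {set V}} :=
  [set [set x; x'] | x in X, x' in X & x != x'] :|:
  [set [set x; y] | x in X, y in Y].

Definition vertex_partition (V : finType) (p q : nat) (X Y : {set V}) : Prop :=
  [/\ X :|: Y = [set: V], [disjoint X & Y], #|X| = p & #|Y| = q].

Definition complete_split (V : finType) (p q : nat) (E : {set {set V}}) : Prop :=
  exists X Y : {set V}, vertex_partition p q X Y /\ E = split_edges X Y.

Definition complete_split_plus_edge (V : finType) (p q : nat)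
    (E : {set {set V}}) : Prop :=
  exists (X Y : {set V}) (u v : V),
    [/\ vertex_partition p q X Y, u \in Y, v \in Y, u != v
      & E = [set u; v] |: split_edges X Y].

Definition two_coloring (V : finType) (R B : {set {set V}}) : bool :=
  (R :|: B == complete V) && [disjoint R & B].

(* A copy of G in K_n is the image of G under an injection of its vertices. *)
Definition balanced_copy (n : nat) (V : finType) (G : {set {set V}})
    (R B : {set {set 'I_n}}) : bool :=
  [exists f : {ffun V -> 'I_n},
    [&& injectiveb f, #|map_edges f G :&: R|.*2 == #|G|
      & #|map_edges f G :&: B|.*2 == #|G|]].

Definition forces_balanced (n : nat) (V : finType) (G : {set {set V}})
    (s : nat) : bool :=
  [forall R : {set {set 'I_n}}, forall B : {set {set 'I_n}},
    two_coloring R B ==> (s < minn #|R| #|B|) ==> balanced_copy G R B].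

Lemma forces_balanced_ex (n : nat) (V : finType) (G : {set {set V}}) :
  exists s, forces_balanced n G s.
Proof.
exists #|complete 'I_n|; apply/forallP => R; apply/forallP => B.
apply/implyP => /andP[/eqP RB _]; apply/implyP.
by rewrite leq_min ltnNge -RB subset_leq_card ?subsetUl.
Qed.

Definition bal (n : nat) (V : finType) (G : {set {set V}}) : nat :=
  ex_minn (forces_balanced_ex n G).

(* F represents the family Bal(n,G), whose members only matter up to          *)
(* isomorphism: F may list one or several graphs of an isomorphism class.     *)
Definition is_Bal (n : nat) (V : finType) (G : {set {set V}})
    (F : {set {set {set 'I_n}}}) : Prop :=
  (forall H, H \in F -> is_graph H /\ #|H| = bal n G) /\
  (forall R B : {set {set 'I_n}},
     two_coloring R B -> minn #|R| #|B| = bal n G ->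
     (~~ balanced_copy G R B <->
      exists2 H, H \in F & graph_iso R H \/ graph_iso B H)).

Definition only_graph (n : nat) (H : {set {set 'I_n}})
    (F : {set {set {set 'I_n}}}) : Prop :=
  F != set0 /\ forall H', H' \in F -> graph_iso H' H.

(* Main.v *)
Require Import Defs.
From mathcomp Require Import all_boot all_order all_algebra.
From mathcomp Require Import zify lra.
Set Implicit Arguments.
Unset Strict Implicit.
Unset Printing Implicit Defensive.

(* Write k = 2m. Reversing a prefix of a path, or changing its first vertex,  *)
(* changes its number of red edges by at most one, and these moves connect    *)
(* any two paths with k edges; so there is no balanced path exactly when, for *)
(* one of the colours, no path has m edges of that colour. A linear forest    *)
(* with m edges extends to a path with 2m edges, so everything reduces to the *)
(* extremal problem for linear forests with m edges. It is solved by          *)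
(* induction from m - 2 to m: a vertex v of degree greater than m can be      *)
(* deleted, since a linear forest with m - 2 edges avoiding v gains two edges *)
(* at v; if there is no such vertex, the graph has at most (m - 1)m edges,    *)
(* which is too few when n is large.                                          *)

(** * Edges of a graph along a sequence of vertices *)

(** The extremal graph has a clique of [p = m.-1./2] vertices joined to everything, plus one edge
    when [m] is even. A path uses at most two edges at each clique vertex, and so at most
    [2p + ~~ odd m = m - 1] edges of this graph ([quasi_split_hit_free]). Conversely,
    [hit_free_extremal] bounds every graph without a linear forest of [m] edges; equality forces
    each deleted vertex to be adjacent to all remaining ones, so these vertices form the clique. The
    two edges gained at a deleted vertex come from [hits_splice]. The passage to colourings is
    [balanced_or_hit_free], a discrete intermediate value argument resting on [seq_walk]. Since the
    extremal graph has fewer than half of all edges, colouring it against its complement shows that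
    the bound is attained, and the section [Balance] turns its uniqueness into the description of
    Bal. *)

Section RunCount.
Variables (V : finType) (e : rel V).
Implicit Types (s t u : seq V) (a b x y : V).

(* The vertices of s joined by e to their successor in s. Those outside this  *)
(* list end distinct components of the linear forest of e-edges along s, so   *)
(* that two of them can always be joined: see hits_splice.                    *)
Fixpoint left_ends s : seq V :=
  if s is x :: t then
    if t is y :: _ then
      if e x y then x :: left_ends t else left_ends t
    else [::]
  else [::].

Definition hits s : nat := size (left_ends s).

Lemma hits_cons2 x y s : hits [:: x, y & s] = e x y + hits (y :: s).
Proof. by rewrite /hits /=; case: (e x y). Qed.

Lemma hits_cat s t : hits s + hits t <= hits (s ++ t).
Proof.
elim: s => [|x [|y s] IH] //.
  by case: t {IH} => [|y t] //=; rewrite hits_cons2 leq_addl.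
by rewrite /= !hits_cons2 -addnA leq_add2l.
Qed.

Lemma hits_join s a b t :
  hits (rcons s a ++ b :: t) = hits (rcons s a) + e a b + hits (b :: t).
Proof.
elim: s => [|x [|y s] IH]; first by rewrite /= hits_cons2.
  by rewrite /= !hits_cons2 addn0 addnA.
by move: IH; rewrite /= !hits_cons2 => ->; rewrite !addnA.
Qed.

Lemma hits_cut s a t : uniq (s ++ a :: t) -> a \notin left_ends (s ++ a :: t) ->
  hits (s ++ a :: t) = hits (rcons s a) + hits t.
Proof.
rewrite -cat_rcons; case: t => [|b t]; first by rewrite cats0 addn0.
move=> us; rewrite hits_join => na; suff -> : e a b = false by rewrite addn0.
apply: contraNF na => eab {us}; rewrite cat_rcons.
elim: s => [|x [|y s] IH] /=; first by rewrite eab mem_head.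
  by rewrite eab; case: (e x a); rewrite !inE eqxx ?orbT.
by case: (e x y); rewrite ?in_cons IH ?orbT.
Qed.

Lemma left_ends_suffix s t : {subset left_ends t <= left_ends (s ++ t)}.
Proof.
elim: s => [|x s IH] //= z /IH; case: (s ++ t) => // y u.
by case: (e x y) => //; rewrite in_cons => ->; rewrite orbT.
Qed.

Hypothesis esym : symmetric e.

Lemma hits_rev s : hits (rev s) = hits s.
Proof.
elim: s => [|x s IH] //; case: s IH => [|y s] // IH.
rewrite rev_cons -cats1 rev_cons hits_join -rev_cons IH hits_cons2 esym.
by rewrite addnC addnA add0n addnC.
Qed.

(** Cutting [s] right after [a] and right after [b] loses no hit. The three pieces are put together
    again, one of them reversed, so that [a] and [b] meet. The junction is left out of the final
    count: it can then receive the edge [ab], or a new vertex adjacent to both. *)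
Lemma hits_splice s a b : uniq s -> a \in s -> b \in s -> a != b ->
    a \notin left_ends s -> b \notin left_ends s ->
  exists u t, perm_eq (rcons u a ++ b :: t) s
              /\ hits s <= hits (rcons u a) + hits (b :: t).
Proof.
have ordered x y s1 s2 s3 : let s' := s1 ++ x :: s2 ++ y :: s3 in
    uniq s' -> x \notin left_ends s' -> y \notin left_ends s' ->
    perm_eq (rcons (s3 ++ s1) x ++ y :: rev s2) s' /\
    hits s' <= hits (rcons (s3 ++ s1) x) + hits (y :: rev s2).
  move=> s' us' xs' ys'; split.
    have -> : s' = (rcons s1 x ++ rcons s2 y) ++ s3.
      by rewrite cat_rcons -catA /= cat_rcons.
    rewrite rcons_cat -rev_rcons -catA perm_sym perm_catC !perm_cat2l.
    by rewrite perm_sym perm_rev.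
  rewrite (hits_cut us' xs') hits_cut.
  - rewrite -rev_rcons hits_rev rcons_cat.
    by have := hits_cat s3 (rcons s1 x); lia.
  - by move: us'; rewrite /s' -cat_rcons cat_uniq => /and3P[].
  apply: contra ys' => /(left_ends_suffix (rcons s1 x)).
  by rewrite cat_rcons.
move=> us a_s b_s neq_ab na nb; case/splitPr: a_s us b_s na nb => s1 s2.
rewrite mem_cat inE eq_sym (negPf neq_ab) /= => us b_s na nb.
case/orP: b_s us na nb => /splitPr[s3 s4].
  rewrite -catA cat_cons => us na nb.
  have [p h] := ordered _ _ _ _ _ us nb na.
  exists (rev (rev s4)), (rev (s2 ++ s3)).
  by rewrite -!rev_cons -[b :: _]rev_rcons !hits_rev -rev_cat perm_rev addnC.
move=> us na nb.
have [p h] := ordered _ _ _ _ _ us na nb; by exists (s4 ++ s1), (rev s3).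
Qed.
End RunCount.

Lemma hits_mono (V : finType) (e e' : rel V) s :
  subrel e e' -> hits e s <= hits e' s.
Proof.
move=> ee'; elim: s => [|x [|y s] IH] //; rewrite !hits_cons2 leq_add //.
by case exy: (e x y) => //; rewrite ee'.
Qed.

(** * Graphs without a linear forest of m edges *)

Section HitFree.
Variable V : finType.
Implicit Types (G : {set {set V}}) (S : {set V}) (s : seq V) (m : nat).

Definition adj G x y := [set x; y] \in G.

Lemma adj_sym G : symmetric (adj G).
Proof. by move=> x y; rewrite /adj setUC. Qed.

Lemma adj_neq G x y : is_graph G -> adj G x y -> x != y.
Proof. by move=> /subsetP gG /gG; rewrite inE cards2; case: (x != y). Qed.

Definition hit_free m G := forall s, uniq s -> hits (adj G) s < m.

Definition star G v := [set f in G | v \in f].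
Definition nbr G v := [set x | adj G v x].

Lemma starE G v : is_graph G -> star G v = [set [set v; x] | x in nbr G v].
Proof.
move=> gG; apply/setP => f; rewrite inE; apply/andP/imsetP => [[fG]|[x]].
  have := subsetP gG f fG; rewrite inE => /cards2P[x [y [_ Df]]].
  rewrite Df in fG *; rewrite !inE => /orP[]/eqP->.
    by exists y; rewrite ?inE.
  by exists x; rewrite ?inE /adj setUC.
by rewrite inE => vx ->; rewrite set21.
Qed.

Lemma card_star G v : is_graph G -> #|star G v| <= #|nbr G v|.
Proof. by move/starE->; apply: leq_imset_card. Qed.

Lemma uniq_extend S s : uniq s -> {subset s <= S} ->
  exists t, uniq (s ++ t) /\ s ++ t =i S.
Proof.
move=> us sS; exists [seq x <- enum S | x \notin s]; split=> [|x].
  rewrite cat_uniq us filter_uniq ?enum_uniq // andbT.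
  by apply/hasPn => x; rewrite mem_filter => /andP[].
rewrite mem_cat mem_filter mem_enum.
by case: (boolP (x \in s)) => //= /sS.
Qed.

Lemma hit_free_delete m G v : is_graph G -> hit_free m.+2 G ->
  m.+2 < #|nbr G v| -> hit_free m (G :\: star G v).
Proof.
move=> gG free_G deg_v s us; rewrite ltnNge; apply/negP => hs.
set G' := G :\: star G v in hs.
have [s1 [us1 vs1 hs1]] : exists s1,
    [/\ uniq s1, {subset s1 <= [set~ v]} & m <= hits (adj G') s1].
  have [vs|nvs] := boolP (v \in s); last first.
    by exists s; split=> // x xs; rewrite !inE; apply: contraNneq nvs => <-.
  case/splitPr: vs us hs => t1 t2.
  rewrite uniq_catC /= mem_cat negb_or => /andP[/andP[n2 n1] ut] hs.
  exists (t1 ++ t2); split; first by rewrite uniq_catC.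
    move=> x; rewrite mem_cat !inE; case: eqP => [->|//].
    by rewrite (negPf n1) (negPf n2).
  apply: leq_trans hs _.
  apply: leq_trans (hits_cat _ _ _).
  have nv x : adj G' v x = false.
    by rewrite /adj /G' !inE eqxx andbT; case: (_ \in G).
  have -> : hits (adj G') (t1 ++ v :: t2) =
            hits (adj G') t1 + hits (adj G') (v :: t2).
    case/lastP: t1 {n1 ut} => [|t1 x]; first by [].
    by rewrite hits_join adj_sym nv addn0.
  rewrite leq_add2l; case: t2 {n2 ut} => [|x t2] //.
  by rewrite hits_cons2 nv.
(* Listing all vertices other than [v] ensures that every neighbour of [v] occurs. *)
have [s2] := uniq_extend us1 vs1; set s0 := s1 ++ s2 => -[us0 s0v].
have hs0 : m <= hits (adj G) s0.
  apply: leq_trans hs1 (leq_trans _ (hits_cat _ _ _)).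
  apply: leq_trans (leq_addr _ _).
  apply: hits_mono => x y; by rewrite /adj /G' inE => /andP[].
have := free_G s0 us0; rewrite ltnS => hs0'.
(* There are at most [m + 1] left ends and at least [m + 3] neighbours of [v]. Two neighbours are
   therefore free, and [v] is inserted between them after splicing. *)
have /card_gt1P[a [b [a_ b_ neq_ab]]] :
    1 < #|nbr G v :\: [set x in left_ends (adj G) s0]|.
  have := cardsID [set x in left_ends (adj G) s0] (nbr G v).
  have : #|nbr G v :&: [set x in left_ends (adj G) s0]| <= hits (adj G) s0.
    apply: leq_trans (card_size _); apply: subset_leq_card.
    by apply/subsetP => x; rewrite !inE => /andP[].
  by lia.
move: a_ b_; rewrite !inE => /andP[na va] /andP[nb vb].
have s0E x : adj G v x -> x \in s0.
  by move/(adj_neq gG); rewrite s0v !inE eq_sym.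
have [u [t [pe ht]]] :=
  hits_splice (@adj_sym G) us0 (s0E _ va) (s0E _ vb) neq_ab na nb.
have := free_G (rcons u a ++ v :: b :: t).
rewrite hits_join hits_cons2 adj_sym va vb ltnNge.
suff -> : uniq (rcons u a ++ [:: v, b & t]) by move=> /(_ isT); lia.
rewrite uniq_catC cat_cons cons_uniq uniq_catC (perm_uniq pe) us0 andbT.
by rewrite mem_cat orbC -mem_cat (perm_mem pe) s0v !inE eqxx.
Qed.

Lemma card_touching d G s : (forall v, #|nbr G v| <= d) -> is_graph G ->
  (forall f, f \in G -> has [in f] s) -> #|G| <= size s * d.
Proof.
move=> deg_d gG touch.
apply: (@leq_trans (\sum_(v <- s) #|star G v|)); last first.
  rewrite big_tnth -[X in X * d]card_ord -sum_nat_const.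
  by apply: leq_sum => i _; apply: leq_trans (card_star _ gG) _.
elim: s G {deg_d gG} touch => [|v s IH] G touch.
  rewrite big_nil leqn0 cards_eq0; apply/eqP/setP => f; rewrite inE.
  by apply/negP => /touch.
rewrite big_cons -(cardsID [set f : {set V} | v \in f] G) leq_add //.
  by apply/eq_leq/eq_card => f; rewrite !inE.
apply: leq_trans (IH _ _) _ => [f|].
  by rewrite !inE => /andP[/negPf nv /touch] /=; rewrite nv.
apply: leq_sum => w _; apply: subset_leq_card; apply/subsetP => f.
by rewrite !inE -andbA => /and3P[_ -> ->].
Qed.

(* In a sequence s of all vertices with as many hits as possible, those       *)
(* outside left_ends s are independent, so left_ends s meets every edge.      *)
Lemma hit_free_low_degree m d G : is_graph G -> hit_free m.+1 G ->
  (forall v, #|nbr G v| <= d) -> #|G| <= m * d.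
Proof.
move=> gG free_G deg_d.
suff H j s : uniq s -> s =i [set: V] -> m - hits (adj G) s < j -> #|G| <= m * d.
  apply: (H m.+1 (enum V) (enum_uniq _)) => [x|].
    by rewrite mem_enum !inE.
  by rewrite ltnS leq_subr.
elim: j s => [|j IH] s us sV // hs; have := free_G s us; rewrite ltnS => hm.
case: (boolP [forall f in G, has [in f] (left_ends (adj G) s)]) =>
    [/forall_inP touch|].
  apply: leq_trans (card_touching deg_d gG touch) _.
  by rewrite leq_mul2r; apply/orP; right.
rewrite negb_forall_in => /exists_inP[f fG /hasPn nf].
have := subsetP gG f fG; rewrite inE => /cards2P[a [b [neq_ab Df]]].
have [] := @hits_splice _ _ (@adj_sym G) s a b; rewrite ?sV ?inE //.
- by apply/negP => /nf; rewrite Df !inE eqxx.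
- by apply/negP => /nf; rewrite Df !inE eqxx orbT.
move=> u [t [pe ht]]; apply: (IH (rcons u a ++ b :: t)).
- by rewrite (perm_uniq pe).
- by move=> x; rewrite (perm_mem pe).
- have ab : adj G a b by rewrite /adj -Df.
  have := free_G (rcons u a ++ b :: t); rewrite (perm_uniq pe) => /(_ us).
  by rewrite !hits_join ab; lia.
Qed.

Definition pairs S := [set f : {set V} | (f \subset S) && (#|f| == 2)].
(** For [Y \subset S], these are the edges of the complete split graph on [S] with clique [S :\: Y]
    and independent part [Y]. *)
Definition touching S (Y : {set V}) := [set f in pairs S | ~~ (f \subset Y)].

(** The number of edges of the extremal graph on [n] vertices, with a clique of size [m.-1./2]; the
    last term is the extra edge. *)
Definition extremal m n :=
  m.-1./2 * (n - m.-1./2) + 'C(m.-1./2, 2) + ~~ odd m.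

Lemma extremalSS m n : 0 < m -> m.-1./2 <= n ->
  extremal m.+2 n.+1 = n + extremal m n.
Proof.
case: m => // m _ /= hn; rewrite /extremal /= negbK binS bin1.
move: ('C(_, _)) hn => c; nia.
Qed.

Lemma low_degree_bound m n : 2 < m -> 6 * m <= n + 5 ->
  m.-1 * m < extremal m n.
Proof.
move=> m3 hn; rewrite /extremal.
have [p Dp Dm] : exists2 p, m.-1./2 = p & m = p.*2.+1 + ~~ odd m.
  by exists (m.-1./2); lia.
rewrite Dp addnAC; apply: leq_trans (leq_addr _ _).
by move: Dm; case: (odd m) => /= Dm; nia.
Qed.

(** Graphs live on a subset [S] of a fixed type, so that deleting a vertex does not change the type.
    The condition [6 * m <= #|S| + 5] survives the passage from [(m, #|S|)] to [(m - 2, #|S| - 1)],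
    and [extremal] then drops by [#|S| - 1], the largest possible degree of the deleted vertex. *)
Theorem hit_free_extremal m S G : 0 < m -> 6 * m <= #|S| + 5 ->
  G \subset pairs S -> hit_free m G ->
  #|G| <= extremal m #|S| /\
  (#|G| = extremal m #|S| ->
   exists Y : {set V},
     [/\ Y \subset S, #|S :\: Y| = m.-1./2 & touching S Y \subset G]).
Proof.
elim/ltn_ind: m S G => m IH S G m_gt0 hS GS free_G.
have gG : is_graph G.
  by apply/subsetP => f /(subsetP GS); rewrite !inE => /andP[].
(* For [m = 1] and [m = 2] the value of [extremal] is 0 and 1, and the clique is empty. *)
have [m_le2|m_gt2] := leqP m 2.
  split; last first.
    exists S; rewrite setDv cards0; split=> //; first by lia.
    by apply/subsetP => f; rewrite !inE => /andP[/andP[->]].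
  case: m m_gt0 free_G m_le2 {IH hS} => [|[|[|m]]] // _ free_G _.
    apply: (leq_trans (hit_free_low_degree (d := #|V|) gG free_G _)) => // v.
    exact: max_card.
  rewrite (hit_free_low_degree (d := 1) gG free_G) // => v.
  rewrite leqNgt; apply/negP => /card_gt1P[a [b [va vb neq_ab]]].
  move: va vb; rewrite !inE => va vb.
  have := free_G [:: a; v; b]; rewrite !hits_cons2 adj_sym va vb /=.
  rewrite !inE negb_or neq_ab eq_sym (adj_neq gG va) (adj_neq gG vb).
  by move=> /(_ isT).
have [/existsP[v deg_v]|] := boolP [exists v, m < #|nbr G v|]; last first.
  rewrite negb_exists => /forallP low.
  have := low_degree_bound m_gt2 hS.
  have : #|G| <= m.-1 * m.
    apply: hit_free_low_degree => // [|v]; first by rewrite prednK.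
    by rewrite leqNgt low.
  by lia.
have nS x : x \in nbr G v -> (x \in S :\ v) && (v \in S).
  rewrite !inE => vx; rewrite eq_sym (adj_neq gG vx) /=.
  have := subsetP GS _ vx; rewrite inE => /andP[/subsetP sS _].
  by rewrite !sS ?inE ?eqxx ?orbT.
have vS : v \in S.
  have /card_gt0P[x /nS/andP[]//] : 0 < #|nbr G v| by apply: leq_trans deg_v.
have cS := cardsD1 v S; rewrite vS in cS.
set S' := S :\ v in cS nS; pose G' := G :\: star G v.
case: m => [|[|m]] // in IH m_gt0 hS free_G m_gt2 deg_v *.
have nS' : nbr G v \subset S' by apply/subsetP => x /nS/andP[].
have GS' : G' \subset pairs S'.
  apply/subsetP => f; rewrite !inE => /andP[nvf fG].
  have := subsetP GS _ fG; rewrite inE => /andP[fS ->]; rewrite andbT.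
  by rewrite subsetD1 fS; move: nvf; rewrite fG.
have [||||le' eq'] := IH m _ S' G' _ _ GS' _.
- by [].
- by lia.
- by lia.
- exact: hit_free_delete.
have cG : #|G| = #|star G v| + #|G'|.
  rewrite -(cardsID (star G v) G) (setIidPr _) //.
  by apply/subsetP => f; rewrite inE => /andP[].
have c1 := card_star v gG; have c2 := subset_leq_card nS'.
have Dex : extremal m.+2 #|S| = #|S'| + extremal m #|S'|.
  by rewrite cS extremalSS //; lia.
rewrite Dex; split=> [|eqG]; first by lia.
have [|Y [YS' cY tY]] := eq'; first by lia.
(* Equality leaves no slack in the degree of [v], which therefore joins the clique. *)
have NS' : nbr G v = S' by apply/eqP; rewrite eqEcard nS'; lia.
exists Y; split.
- exact: subset_trans YS' (subD1set _ _).
- have -> : S :\: Y = v |: (S' :\: Y).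
    apply/setP => x; rewrite !inE; case: eqP => //= ->; rewrite vS andbT.
    by apply/negP => /(subsetP YS'); rewrite !inE eqxx.
  by rewrite cardsU1 !inE eqxx andbF /= cY; lia.
- apply/subsetP => f; rewrite !inE => /andP[/andP[fS f2] fY].
  have [vf|vf] := boolP (v \in f).
    have /cards2P[x [y [neq_xy Df]]] := f2.
    have : f \in star G v; last by rewrite inE => /andP[].
    rewrite starE // NS'; move: vf fS; rewrite Df !inE subUset !sub1set.
    case/orP => /eqP Dv /andP[xS yS]; apply/imsetP.
      by exists y; rewrite -?Dv // !inE yS Dv eq_sym neq_xy.
    by exists x; rewrite -?Dv 1?setUC // !inE xS Dv neq_xy.
  have : f \in G' by apply: (subsetP tY); rewrite !inE subsetD1 fS vf f2.
  by rewrite inE => /andP[].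
Qed.
End HitFree.

(** * Interpolation between paths *)

Section Interpolation.
Variables (V : finType) (e : rel V).
Hypothesis esym : symmetric e.
Implicit Types s t a b c : seq V.

(** Keep both ends of [j] hits; vertices that become consecutive can only add hits. *)
Lemma hits_trim s j : uniq s -> j <= hits e s ->
  exists s', [/\ subseq s' s, size s' <= j.*2 & j <= hits e s'].
Proof.
elim: s j => [|x [|y s] IH] [|j] //; try by exists [::].
rewrite hits_cons2 => us hs; have us' : uniq (y :: s) by case/andP: us.
case exy: (e x y) hs => /= hs; last first.
  have [s' [sub sz hs']] := IH _ us' hs; exists s'; split=> //.
  by apply: subseq_trans sub (subseq_cons _ _).
have [|s' [sub sz hs']] := IH j us'; first by lia.
case: s' sub sz hs' => [|z s'].
  move=> _ _; exists [:: x; y]; rewrite hits_cons2 exy /= !eqxx sub0seq.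
  by split=> //; lia.
rewrite [subseq _ _]/=; case: eqP => [->|_] sub sz hs'.
  exists [:: x, y & s']; rewrite hits_cons2 exy /= !eqxx; split=> //.
  by move: sz => /=; lia.
exists [:: x, y, z & s']; rewrite !hits_cons2 exy; split; last 1 first.
- by lia.
- by rewrite /= !eqxx.
- by move: sz => /=; lia.
Qed.

Lemma hits_cat_le s t : hits e (s ++ t) <= (hits e s + hits e t).+1.
Proof.
case/lastP: s => [|s x]; first by rewrite leqW.
case: t => [|y t]; first by rewrite cats0 addn0 leqW.
by rewrite hits_join; case: (e x y); lia.
Qed.

Lemma hits_cons_le x s : hits e s <= hits e (x :: s) <= (hits e s).+1.
Proof. by case: s => // y s; rewrite hits_cons2; case: (e x y); lia. Qed.

Lemma perm_catrev a c : perm_eq (rev a ++ c) (a ++ c).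
Proof. by rewrite perm_cat2r perm_rev. Qed.

(** The target is built from its right end, as in sorting by prefix reversals. The next vertex [x]
    is brought to the front, by a reversal if it occurs in the unsettled prefix and by replacing the
    first vertex otherwise; a second reversal moves it next to the settled suffix [c]. *)
Lemma seq_walk (Q : seq V -> Prop) N :
  (forall a c, uniq (a ++ c) -> size (a ++ c) = N -> Q (a ++ c) ->
     Q (rev a ++ c)) ->
  (forall x y c, uniq (x :: c) -> uniq (y :: c) -> size (x :: c) = N ->
     Q (x :: c) -> Q (y :: c)) ->
  forall s t, uniq s -> uniq t -> size s = N -> size t = N -> Q s -> Q t.
Proof.
move=> Qrev Qrep s t us ut sN tN Qs.
suff H b a c : size a = size b -> size (a ++ c) = N -> uniq (a ++ c) ->
    uniq (b ++ c) -> Q (a ++ c) -> Q (b ++ c).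
  by rewrite -[t]cats0; apply: (H t s [::]); rewrite ?cats0 // sN.
elim/last_ind: b a c => [|b x IH] a c; first by case: a.
rewrite size_rcons => sab saN uac; rewrite cat_rcons => ubc Qa.
have [a' [sa' ua' Qa']] : exists a',
    [/\ size a' = size b, uniq (a' ++ x :: c) & Q (a' ++ x :: c)].
  have front a0 : size a0 = size b -> uniq (x :: a0 ++ c) ->
      Q ((x :: a0) ++ c) -> exists a',
      [/\ size a' = size b, uniq (a' ++ x :: c) & Q (a' ++ x :: c)].
    move=> s0 u0 Q0; exists (rev a0); rewrite size_rev; split=> //.
      rewrite (perm_uniq (perm_catrev _ _)) -cat1s uniq_catCA.
      by move: u0.
    rewrite -cat_rcons -rev_cons; apply: Qrev => //.
    by move: saN; rewrite /= !size_cat; lia.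
  have [xa|nxa] := boolP (x \in a).
    case/splitPr: xa sab saN uac Qa => a1 a2 sab saN uac Qa.
    apply: (front (rev a1 ++ a2)).
    - by move: sab; rewrite !size_cat size_rev /=; lia.
    - rewrite -catA -cat1s uniq_catCA (perm_uniq (perm_catrev _ _)) uniq_catCA.
      by rewrite uniq_catCA; move: uac; rewrite -catA.
    - move: uac saN Qa; rewrite -cat_rcons -!catA => uac saN.
      move/(Qrev _ _ uac saN).
      by rewrite rev_rcons /= catA.
  case: a sab saN uac nxa Qa => // y a0 [sab] saN uac nxa Qa.
  have ux : uniq (x :: a0 ++ c).
    move: nxa ubc uac; rewrite inE negb_or => /andP[_ xa0].
    rewrite cat_uniq => /and3P[_ _ /andP[xc _]] /andP[_ uac0].
    by rewrite cons_uniq mem_cat negb_or xa0 xc.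
  exact: (front a0 sab ux (Qrep _ _ _ uac ux saN Qa)).
apply: IH Qa' => //.
by move: saN; rewrite !size_cat /= sa' sab; lia.
Qed.

Lemma hits_interpolate N m s t : uniq s -> uniq t -> size s = N -> size t = N ->
  hits e t <= m <= hits e s ->
  exists u, [/\ uniq u, size u = N & hits e u = m].
Proof.
move=> us ut sN tN /andP[ht hs].
pose goal := exists u, [/\ uniq u, size u = N & hits e u = m].
(* Each move changes the number of hits by at most one, so a walk from above [m] cannot get below
   [m] without meeting the value [m]. *)
pose Q u := m < hits e u \/ goal.
have step u : uniq u -> size u = N -> m <= hits e u -> Q u.
  by rewrite leq_eqVlt => uu su /predU1P[hu|]; [right; exists u | left].
suff : Q t by case=> //; lia.
apply: (@seq_walk Q N) us ut sN tN (step s us sN hs)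
  => [a c uac sac|x y c ux uy sx].
  case=> [h|]; last by right.
  apply: step; rewrite ?size_cat ?size_rev -?size_cat //.
    by rewrite cat_uniq rev_uniq (eq_has (mem_rev _)) -cat_uniq.
  have := hits_cat e (rev a) c; have := hits_cat_le a c.
  by rewrite hits_rev //; lia.
case=> [h|]; last by right.
apply: step => //; have := hits_cons_le x c; have := hits_cons_le y c; lia.
Qed.
End Interpolation.

(** * Copies of a path as duplicate-free sequences of vertices *)

Fixpoint pedges (V : finType) (s : seq V) : seq {set V} :=
  if s is x :: t then if t is y :: _ then [set x; y] :: pedges t else [::]
  else [::].

Lemma hits_pedges (V : finType) (G : {set {set V}}) s :
  hits (adj G) s = count [in G] (pedges s).
Proof. by elim: s => [|x [|y s] IH] //; rewrite hits_cons2 IH. Qed.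

Lemma size_pedges (V : finType) (s : seq V) : size (pedges s) = (size s).-1.
Proof. by elim: s => [|x [|y s] IH] //=; rewrite IH. Qed.

Lemma pedges_subset (V : finType) (s : seq V) f :
  f \in pedges s -> {subset f <= s}.
Proof.
elim: s => [|x [|y s] IH] //; rewrite inE => /predU1P[->|/IH h] z.
  by rewrite !inE => /orP[]->; rewrite ?orbT.
by move/h => zs; rewrite in_cons zs orbT.
Qed.

Lemma uniq_pedges (V : finType) (s : seq V) : uniq s -> uniq (pedges s).
Proof.
elim: s => [|x [|y s] IH] // /andP[xs us].
rewrite -[pedges _]/([set x; y] :: pedges (y :: s)).
rewrite cons_uniq IH // andbT; apply: contra xs => xy.
by apply: (pedges_subset xy); rewrite set21.
Qed.

Lemma pedgesP (V : finType) x0 (s : seq V) f :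
  reflect (exists2 i, i.+1 < size s & f = [set nth x0 s i; nth x0 s i.+1])
          (f \in pedges s).
Proof.
apply: (iffP idP) => [|[i si ->]].
  elim: s => [|x [|y s] IH] //; rewrite inE => /predU1P[->|/IH[i si ->]].
    by exists 0.
  by exists i.+1.
elim: s i si => [|x [|y s] IH] // [|i] si; first exact: mem_head.
by rewrite in_cons (IH i) ?orbT.
Qed.

Lemma map_edges_path (V : finType) k (f : {ffun 'I_k.+1 -> V}) :
  map_edges f (path_graph k) =i pedges (codom f).
Proof.
have nthf i : i < k.+1 -> nth (f ord0) (codom f) i = f (inord i).
  move=> ik; rewrite /codom (nth_map ord0) ?size_enum_ord //; congr (f _).
  by apply/val_inj; rewrite /= nth_enum_ord // inordK.
move=> g; apply/imsetP/(pedgesP (f ord0)) => [[h /imsetP[i _ ->] ->]|[i si ->]].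
  have ik := ltn_ord i; exists i; first by rewrite size_codom card_ord.
  by rewrite (nthf i) ?(leqW ik) // nthf // imsetU !imset_set1.
rewrite size_codom card_ord in si.
exists [set inord i; inord i.+1].
  by apply/imsetP; exists (Ordinal (si : i < k)).
by rewrite (nthf i) ?(ltnW si) // nthf // imsetU !imset_set1.
Qed.

Lemma card_map_path (V : finType) k (f : {ffun 'I_k.+1 -> V}) G :
  injective f -> #|map_edges f (path_graph k) :&: G| = hits (adj G) (codom f).
Proof.
move=> injf; rewrite hits_pedges -size_filter.
have /card_uniqP <- : uniq (filter [in G] (pedges (codom f))).
  by apply/filter_uniq/uniq_pedges; rewrite map_inj_uniq ?enum_uniq.
by apply: eq_card => g; rewrite inE map_edges_path mem_filter andbC.
Qed.

Lemma card_path_graph k : #|path_graph k| = k.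
Proof.
(* The path is its own image under the identity, so [card_map_path] counts its edges. *)
have <- : map_edges [ffun x : 'I_k.+1 => x] (path_graph k) = path_graph k.
  rewrite /map_edges -[RHS]imset_id; apply: eq_imset => h.
  by rewrite -[RHS]imset_id; apply: eq_imset => x; rewrite ffunE.
rewrite -[X in #|pred_of_set X|]setIT card_map_path; last first.
  by move=> x y; rewrite !ffunE.
rewrite hits_pedges; under eq_count => x do rewrite inE.
by rewrite count_predT size_pedges size_codom card_ord.
Qed.

(** * Balanced paths in two-colourings *)

Lemma two_coloring_hits (V : finType) (R B : {set {set V}}) s :
  two_coloring R B -> uniq s -> hits (adj R) s + hits (adj B) s = (size s).-1.
Proof.
move=> /andP[/eqP RB dRB]; elim: s => [|x [|y s] IH] // /andP[xs us].
rewrite !hits_cons2 addnACA IH //= -[in RHS]add1n; congr (_ + _).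
have : [set x; y] \in complete V.
  by rewrite inE cards2; move: xs; rewrite inE negb_or => /andP[->].
rewrite -RB inE /adj; case: (boolP (_ \in R)) => [xR|_ /= -> //] _.
by rewrite (disjointFr dRB xR).
Qed.

Lemma balanced_pathP n m (R B : {set {set 'I_n}}) : two_coloring R B ->
  reflect (exists s, [/\ uniq s, size s = m.*2.+1 & hits (adj R) s = m])
          (balanced_copy (path_graph m.*2) R B).
Proof.
move=> RB; apply: (iffP existsP) => [[f]|[s [us ss hs]]].
  rewrite card_path_graph => /and3P[/injectiveP injf /eqP hR _].
  exists (codom f); rewrite map_inj_uniq ?enum_uniq // size_codom card_ord.
  by rewrite -(card_map_path R injf); split=> //; apply: double_inj.
have [x0 _] : exists x : 'I_n, x \in s.
  by case: s ss {us hs} => // x s; exists x; rewrite mem_head.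
pose f := [ffun i : 'I_m.*2.+1 => nth x0 s i].
have cf : codom f = s.
  apply: (@eq_from_nth _ x0); rewrite size_codom card_ord // => i im.
  by rewrite /codom (nth_map ord0) ?size_enum_ord // ffunE nth_enum_ord.
have injf : injective f.
  move=> i j; rewrite !ffunE => /eqP; rewrite nth_uniq ?ss // => /eqP.
  exact: val_inj.
exists f; rewrite card_path_graph !card_map_path // cf.
have := two_coloring_hits RB us; rewrite ss hs /= => hB.
have -> : hits (adj B) s = m by apply/(@addnI m); rewrite addnn.
by rewrite eqxx !andbT; apply/injectiveP.
Qed.

(** Every duplicate-free sequence extends to an enumeration of [V] without losing hits, so finitely
    many tuples decide the matter. *)
Lemma hit_free_or (V : finType) m (G : {set {set V}}) :
  hit_free m G \/ exists2 s, uniq s & m <= hits (adj G) s.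
Proof.
have [/existsP[t /andP[ut ht]]|] :=
    boolP [exists t : #|V|.-tuple V, uniq t && (m <= hits (adj G) t)].
  by right; exists t.
rewrite negb_exists => /forallP free_G; left=> s us.
have [|t [ut tV]] := @uniq_extend V [set: V] s us.
  by move=> x; rewrite inE.
have szt : size (s ++ t) == #|V|.
  by rewrite -(card_uniqP ut) (eq_card tV) cardsT.
have := free_G (Tuple szt); rewrite /= ut /= -ltnNge.
apply: leq_ltn_trans; exact: leq_trans (leq_addr _ _) (hits_cat _ _ _).
Qed.

(** At most [2m] vertices carry [m] hits; arbitrary further vertices may follow them. *)
Lemma hits_window (V : finType) m (G : {set {set V}}) s :
    m.*2 < #|V| -> uniq s -> m <= hits (adj G) s ->
  exists s', [/\ uniq s', size s' = m.*2.+1 & m <= hits (adj G) s'].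
Proof.
move=> mV us /(hits_trim us)[t [sub szt ht]].
have ut := subseq_uniq sub us.
have [|u [utu tuV]] := @uniq_extend V [set: V] t ut.
  by move=> x; rewrite inE.
have sztu : size (t ++ u) = #|V|.
  by rewrite -(card_uniqP utu) (eq_card tuV) cardsT.
exists (take m.*2.+1 (t ++ u)).
rewrite take_uniq // size_takel ?sztu //; split=> //.
rewrite take_cat ltnNge (leq_trans szt) //=.
exact: leq_trans ht (leq_trans (leq_addr _ _) (hits_cat _ _ _)).
Qed.

(** If neither colour is free, one path has at least [m] red edges and another at least [m] blue
    ones, so at most [m] red ones; interpolation gives exactly [m]. *)
Lemma balanced_or_hit_free n m (R B : {set {set 'I_n}}) :
    m.*2 < n -> two_coloring R B ->
  [\/ balanced_copy (path_graph m.*2) R B, hit_free m R | hit_free m B].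
Proof.
move=> mn RB; rewrite -[n]card_ord in mn.
have [|[s us hs]] := hit_free_or m R; first by constructor 2.
have [|[t ut ht]] := hit_free_or m B; first by constructor 3.
constructor 1; apply/balanced_pathP => //.
have [{hs}s' {us}[us ss hs]] := hits_window mn us hs.
have [{ht}t' {ut}[ut st ht]] := hits_window mn ut ht.
apply: (hits_interpolate (@adj_sym _ R) us ut ss st).
rewrite hs andbT -(leq_add2r (hits (adj B) t')) two_coloring_hits // st /=.
by rewrite -addnn leq_add2l.
Qed.

(** * Invariance under isomorphism *)

Section Iso.
Implicit Types V W : finType.

Lemma mem_map_edges V W (f : V -> W) (E : {set {set V}}) (h : {set V}) :
  injective f -> (f @: h \in map_edges f E) = (h \in E).
Proof. by move=> injf; rewrite /map_edges mem_imset //; apply: imset_inj. Qed.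

Lemma card_map_edges V W (f : V -> W) (E : {set {set V}}) :
  injective f -> #|map_edges f E| = #|E|.
Proof. by move=> injf; apply/card_imset/imset_inj. Qed.

Lemma hits_map_edges V W (f : V -> W) (E : {set {set V}}) s :
  injective f -> hits (adj (map_edges f E)) (map f s) = hits (adj E) s.
Proof.
move=> injf; elim: s => [|x [|y s] IH] //; rewrite /= !hits_cons2 IH.
by congr (_ + _); rewrite /adj -(mem_map_edges _ _ injf) imsetU !imset_set1.
Qed.

Lemma graph_iso_refl V (E : {set {set V}}) : graph_iso E E.
Proof.
exists id; first by exists id.
rewrite -[RHS]imset_id /map_edges; apply: eq_imset => h; exact: imset_id.
Qed.

Lemma graph_iso_sym V W (E : {set {set V}}) (F : {set {set W}}) :
  graph_iso E F -> graph_iso F E.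
Proof.
case=> f [g fK gK] <-; exists g; first by exists f.
rewrite /map_edges -imset_comp -[RHS]imset_id; apply: eq_imset => h /=.
by rewrite -imset_comp -[RHS]imset_id; apply: eq_imset => x /=.
Qed.

Lemma graph_iso_trans V W U (E : {set {set V}}) (F : {set {set W}})
    (G : {set {set U}}) : graph_iso E F -> graph_iso F G -> graph_iso E G.
Proof.
case=> f bf <- [g bg <-]; exists (g \o f); first exact: bij_comp.
rewrite /map_edges -imset_comp; apply: eq_imset => h /=.
by rewrite -imset_comp.
Qed.

Lemma graph_iso_is_graph V W (E : {set {set V}}) (F : {set {set W}}) :
  graph_iso E F -> is_graph F -> is_graph E.
Proof.
case=> f /bij_inj injf <- /subsetP gF; apply/subsetP => h hE.
have := gF (f @: h); rewrite mem_map_edges // => /(_ hE).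
by rewrite !inE card_imset.
Qed.

Lemma graph_iso_card V W (E : {set {set V}}) (F : {set {set W}}) :
  graph_iso E F -> #|E| = #|F|.
Proof. by case=> f /bij_inj injf <-; rewrite card_map_edges. Qed.

Lemma graph_iso_hit_free V W m (E : {set {set V}}) (F : {set {set W}}) :
  graph_iso E F -> hit_free m F -> hit_free m E.
Proof.
case=> f /bij_inj injf <- free_F s us.
by rewrite -(hits_map_edges _ _ injf) free_F // map_inj_uniq.
Qed.

Lemma map_uniq_bij V (l l' : seq V) : uniq l -> uniq l' ->
    l =i [set: V] -> l' =i [set: V] ->
  exists2 f : V -> V, bijective f & map f l = l'.
Proof.
move=> ul ul' lV l'V.
have szl : size l = size l'.
  by rewrite -(card_uniqP ul) -(card_uniqP ul') (eq_card lV) (eq_card l'V).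
have mem x : (x \in l) * (x \in l') by rewrite lV l'V !inE.
exists (fun x => nth x l' (index x l)).
  exists (fun x => nth x l (index x l')) => x.
    rewrite index_uniq -?szl ?index_mem ?mem //.
    by rewrite (set_nth_default x) ?nth_index ?index_mem ?mem.
  rewrite index_uniq ?szl ?index_mem ?mem //.
  by rewrite (set_nth_default x) ?nth_index ?index_mem ?mem.
case: l ul szl {lV mem} => [|x0 l] ul szl; first by case: l' szl {ul' l'V}.
apply: (@eq_from_nth _ x0); rewrite size_map // => i il.
by rewrite (nth_map x0) // index_uniq //; apply: set_nth_default; rewrite -szl.
Qed.
End Iso.

(** * Split graphs *)

Section SplitGraphs.
Variable V : finType.
Implicit Types (E : {set {set V}}) (X Y : {set V}) (p m : nat) (b : bool).

(* The complete (p, #|V| - p)-split graph, plus one edge if b. *)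
Definition quasi_split p b E := exists Y,
  [/\ #|~: Y| = p, touching [set: V] Y \subset E, is_graph E
    & #|E| = #|touching [set: V] Y| + b].

Lemma touchingE Y :
  touching [set: V] Y = [set f in complete V | ~~ (f \subset Y)].
Proof. by apply/setP => f; rewrite !inE subsetT. Qed.

Lemma split_edgesE X Y : X = ~: Y -> split_edges X Y = touching [set: V] Y.
Proof.
move=> ->; apply/setP => f; rewrite touchingE !inE.
apply/orP/andP => [[/imset2P[x y xX]|/imset2P[x y xX yY ->]]|].
- rewrite inE => /andP[yX neq_xy] ->; rewrite cards2 neq_xy subUset sub1set.
  by move: xX; rewrite inE => /negPf->.
- move: xX; rewrite inE => nxY; rewrite cards2 subUset sub1set (negPf nxY).
  by have -> : x != y by apply: contraNneq nxY => ->.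
case=> /cards2P[x [y [neq_xy ->]]]; rewrite subUset !sub1set => nXY.
have [xY|xY] := boolP (x \in Y).
  right; rewrite xY /= in nXY; rewrite setUC.
  by apply/imset2P; exists y x; rewrite ?inE.
have [yY|yY] := boolP (y \in Y).
  by right; apply/imset2P; exists x y; rewrite ?inE.
by left; apply/imset2P; exists x y; rewrite ?inE ?yY.
Qed.

Lemma card_complete : #|complete V| = 'C(#|V|, 2).
Proof.
rewrite -[#|V|]cardsT -cards_draws; apply: eq_card => f.
by rewrite !inE subsetT.
Qed.

Lemma card_touching_setT Y p : #|~: Y| = p ->
  #|touching [set: V] Y| = p * (#|V| - p) + 'C(p, 2).
Proof.
move=> cX; have cV := cardsC Y; rewrite cX in cV.
have := cardsID (powerset Y) (complete V).
have -> : complete V :&: powerset Y =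
          [set f : {set V} | f \subset Y & #|f| == 2].
  by apply/setP => f; rewrite !inE andbC.
have -> : complete V :\: powerset Y = touching [set: V] Y.
  by rewrite touchingE; apply/setP => f; rewrite !inE andbC.
rewrite cards_draws card_complete -cV addnK.
have -> : forall q, 'C(q + p, 2) = 'C(q, 2) + (p * q + 'C(p, 2)).
  move=> q; elim: {cX cV} p => [|p IH]; first by rewrite bin0n !addn0.
  by rewrite addnS !binS !bin1 IH; lia.
by move/addnI.
Qed.

Lemma vertex_partitionP p X Y : p <= #|V| ->
  vertex_partition p (#|V| - p) X Y <-> X = ~: Y /\ #|~: Y| = p.
Proof.
move=> pV; split=> [[XY dXY cX _]|[-> cY]].
  have DX : X = ~: Y.
    apply/setP => x; have : x \in X :|: Y by rewrite XY inE.
    rewrite !inE; case: (boolP (x \in X)) => [xX|_ /= -> //] _.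
    by rewrite (disjointFr dXY xX).
  by rewrite -DX.
split=> //; first by rewrite setUC setUCr.
  by rewrite disjoints_subset.
by rewrite -cY -(cardsC Y) addnK.
Qed.

Lemma complete_splitE p E : p <= #|V| ->
  complete_split p (#|V| - p) E <-> quasi_split p false E.
Proof.
move=> pV.
split=> [[X [Y [/vertex_partitionP[//|DX cY] ->]]]|[Y [cY TE gE cE]]].
  exists Y; rewrite split_edgesE // addn0; split=> //.
  by rewrite touchingE; apply/subsetP => f; rewrite inE => /andP[].
exists (~: Y), Y; split; first by apply/(vertex_partitionP _ _ pV).
rewrite split_edgesE //; apply/esym/eqP.
by rewrite eqEcard TE cE addn0 leqnn.
Qed.

Lemma complete_split_plus_edgeE p E : p <= #|V| ->
  complete_split_plus_edge p (#|V| - p) E <-> quasi_split p true E.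
Proof.
move=> pV; split=> [[X [Y [u [v [/vertex_partitionP[//|DX cY]]]]]]|].
  move=> uY vY neq_uv ->.
  exists Y; rewrite split_edgesE //; split=> //; first exact: subsetUr.
    rewrite touchingE; apply/subsetP => f; rewrite in_setU1 => /predU1P[->|].
      by rewrite inE cards2 neq_uv.
    by rewrite inE => /andP[].
  by rewrite cardsU1 touchingE !inE subUset !sub1set uY vY andbF addnC.
case=> Y [cY TE gE cE].
have /cards1P[f Df] : #|E :\: touching [set: V] Y| == 1.
  by rewrite cardsD (setIidPr TE) cE addKn.
have : f \in E :\: touching [set: V] Y by rewrite Df set11.
rewrite touchingE !inE => /andP[nfT fE].
have := subsetP gE f fE; rewrite inE => f2; rewrite f2 /= negbK in nfT.
have /cards2P[u [v [neq_uv Duv]]] := f2.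
move: nfT; rewrite Duv subUset !sub1set => /andP[uY vY].
exists (~: Y), Y, u, v; split=> //; first by apply/(vertex_partitionP _ _ pV).
rewrite split_edgesE // -Duv -Df setUC.
by rewrite -[LHS](setID _ (touching [set: V] Y)) (setIidPr TE).
Qed.

Lemma count_le_card (T : finType) (A : {set T}) (s : seq T) :
  uniq s -> count [in A] s <= #|A|.
Proof.
move=> us; rewrite -size_filter -(card_uniqP (filter_uniq _ us)).
by apply/subset_leq_card/subsetP => x; rewrite mem_filter => /andP[].
Qed.

Lemma hits_touching Y s :
  hits (adj (touching [set: V] Y)) s <= (count [in ~: Y] s).*2.
Proof.
case: s => // x s; set T := touching _ _.
(* Strengthened for the induction: a first vertex in the clique has only one path edge so far, which
   leaves room for an edge before it. *)
suff : hits (adj T) (x :: s) + (x \notin Y) <= (count [in ~: Y] (x :: s)).*2.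
  by apply: leq_trans; apply: leq_addr.
elim: s x => [|y s IH] x; first by rewrite /= inE; case: (x \in Y).
rewrite hits_cons2; have := IH y; rewrite /= !inE.
have : adj T x y -> (x \notin Y) || (y \notin Y).
  by rewrite /adj /T touchingE !inE subUset !sub1set negb_and => /andP[].
case: (adj T x y) => [/(_ isT)|_];
  by case: (x \in Y); case: (y \in Y) => //=; lia.
Qed.

Lemma quasi_split_hit_free m E : 0 < m ->
  quasi_split m.-1./2 (~~ odd m) E -> hit_free m E.
Proof.
move=> m_gt0 [Y [cY TE gE cE]] s us; set T := touching _ _ in TE cE.
have hE : hits (adj E) s <= hits (adj T) s + ~~ odd m.
  have cET : #|E :\: T| = ~~ odd m by rewrite cardsD (setIidPr TE) cE addKn.
  rewrite !hits_pedges -cET.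
  apply: leq_trans (leq_add (leqnn _) (count_le_card _ (uniq_pedges us))).
  rewrite -count_predUI; apply: leq_trans (leq_addr _ _).
  apply: sub_count => f /=.
  by rewrite !inE => ->; rewrite andbT orbN.
have := count_le_card (~: Y) us; have := hits_touching Y s.
by rewrite cY -/T; lia.
Qed.

Lemma hit_free_quasi_split m E : 0 < m -> 6 * m <= #|V| + 5 -> is_graph E ->
    hit_free m E ->
  #|E| <= extremal m #|V| /\
  (#|E| = extremal m #|V| -> quasi_split m.-1./2 (~~ odd m) E).
Proof.
move=> m_gt0 hV gE free_E.
have gE' : E \subset pairs [set: V].
  by apply: subset_trans gE _; apply/subsetP => f; rewrite !inE subsetT.
have [|le_E eq_E] := hit_free_extremal m_gt0 _ gE' free_E.
  by rewrite cardsT.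
rewrite cardsT in le_E eq_E; split=> // /[dup] cE /eq_E[Y [_ cY TE]].
rewrite setTD in cY; exists Y; split=> //.
by rewrite cE (card_touching_setT cY).
Qed.

(** A normal form giving uniqueness up to isomorphism: clique [x], ends [w] of the extra edge,
    remaining vertices [z]. Matching two such listings position by position is an isomorphism. *)
Lemma quasi_split_listing p b E : quasi_split p b E -> exists x w z,
  [/\ uniq (x ++ w ++ z), x ++ w ++ z =i [set: V], size x = p, size w = b.*2
    & E = [set f in complete V | has [in f] x || b && (f == [set y in w])]].
Proof.
case=> Y [cY TE gE cE].
have [w [uw wY sw DE]] : exists w,
    [/\ uniq w, {subset w <= Y}, size w = b.*2 &
      E = [set f in complete V | ~~ (f \subset Y) || b && (f == [set y in w])]].
  have cD : #|E :\: touching [set: V] Y| = b.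
    by rewrite cardsD (setIidPr TE) cE addKn.
  have DE f : f \in E =
      (f \in touching [set: V] Y) || (f \in E :\: touching [set: V] Y).
    by rewrite in_setD; case: (boolP (f \in touching _ _)) => // /(subsetP TE).
  case: b cD {cE} => cD.
    have /cards1P[f Df] : #|E :\: touching [set: V] Y| == 1 by rewrite cD.
    have : f \in E :\: touching [set: V] Y by rewrite Df set11.
    rewrite touchingE !inE => /andP[nfT fE].
    have := subsetP gE f fE; rewrite inE => f2; rewrite f2 /= negbK in nfT.
    exists (enum f); rewrite enum_uniq -cardE (eqP f2) set_enum; split=> //.
      by move=> y; rewrite mem_enum => /(subsetP nfT).
    apply/setP => h; rewrite DE Df touchingE !inE.
    by case: (h =P f) => [->|_]; rewrite ?f2 !(orbT, orbF).
  exists [::]; split=> //; apply/setP => h; rewrite DE.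
  by move/eqP: cD; rewrite cards_eq0 => /eqP->; rewrite touchingE !inE !orbF.
have [z [uz zY]] := uniq_extend uw wY.
exists (enum (~: Y)), w, z; rewrite -cardE; split=> //.
- rewrite cat_uniq enum_uniq uz andbT; apply/hasPn => y.
  by rewrite zY mem_enum inE negbK.
- by move=> y; rewrite mem_cat zY mem_enum !inE; case: (y \in Y).
rewrite DE; apply/setP => f; rewrite !inE; congr (_ && (_ || _)).
apply/subsetPn/hasP => -[y].
  by move=> yf yY; exists y; rewrite ?mem_enum ?inE.
by rewrite mem_enum inE => yY yf; exists y.
Qed.

Lemma quasi_split_iso p b E E' :
  quasi_split p b E -> quasi_split p b E' -> graph_iso E E'.
Proof.
move=> /quasi_split_listing[x [w [z [ul lV sx sw ->]]]].
move=> /quasi_split_listing[x' [w' [z' [ul' lV' sx' sw' ->]]]].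
have [f bf Df] := map_uniq_bij ul ul' lV lV'; exists f => //.
have /andP[/eqP Dx /eqP Dw] : (map f x == x') && (map f w == w').
  move/eqP: Df; rewrite !map_cat eqseq_cat ?size_map ?sx ?sx' // => /andP[->].
  by rewrite eqseq_cat ?size_map ?sw ?sw' // => /andP[->].
case: (bf) => g fK gK; have injf := bij_inj bf; apply/setP => h.
have -> : h = f @: (g @: h).
  by rewrite -imset_comp -[LHS]imset_id; apply: eq_imset => y /=.
rewrite mem_map_edges // !inE (card_imset _ injf) -Dx has_map.
congr (_ && (_ || _)).
  by apply: eq_has => y /=; rewrite mem_imset.
congr (_ && _); rewrite -Dw -(inj_eq (imset_inj injf)); congr (_ == _).
apply/setP => y; rewrite inE; apply/imsetP/mapP => -[u uw ->].
  by exists u; rewrite // inE in uw *.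
by exists u; rewrite ?inE.
Qed.

Lemma quasi_split_exists p b : p + b.*2 <= #|V| -> exists E, quasi_split p b E.
Proof.
move=> pV; pose Y := ~: [set y in take p (enum V)].
have cX : #|~: Y| = p.
  rewrite setCK cardsE (card_uniqP (take_uniq _ (enum_uniq _))).
  by rewrite size_takel // -cardE; apply: leq_trans pV; apply: leq_addr.
have cY : b.*2 <= #|Y| by have := cardsC Y; lia.
have gT : is_graph (touching [set: V] Y).
  by rewrite touchingE; apply/subsetP => f; rewrite inE => /andP[].
case: b cY {pV} => cY; last first.
  by exists (touching [set: V] Y), Y; rewrite addn0.
have /card_gt1P[u [v [uY vY neq_uv]]] := cY.
exists ([set u; v] |: touching [set: V] Y), Y; split=> //.
  exact: subsetUr.
  rewrite /is_graph subUset [X in _ && X]gT andbT sub1set.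
  by rewrite inE cards2 neq_uv.
by rewrite cardsU1 touchingE !inE subUset !sub1set uY vY andbF addnC.
Qed.
End SplitGraphs.

Lemma two_coloring_setD (V : finType) (E : {set {set V}}) :
  is_graph E -> two_coloring E (complete V :\: E).
Proof.
move=> gE; apply/andP; split; last first.
  by rewrite disjoint_sym disjoints_subset setDE subsetIr.
by rewrite setUC -[in X in _ == X](setID (complete V) E) (setIidPr gE) setUC.
Qed.

(** * The balancing number *)

Section Balance.
(** [H] stands for the extremal graph, and the hypotheses record the solved extremal problem. By
    [small_H], its complement has more edges than [H]. *)
Variables (n m : nat) (H : {set {set 'I_n}}).
Hypotheses (hmn : m.*2 < n) (gH : is_graph H)
  (max_H : forall E : {set {set 'I_n}},
     is_graph E -> hit_free m E -> #|E| <= #|H|)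
  (iso_H : forall E : {set {set 'I_n}}, is_graph E ->
     (hit_free m E /\ #|E| = #|H|) <-> graph_iso E H)
  (small_H : #|H|.*2 < #|complete 'I_n|).

Lemma two_coloringC (R B : {set {set 'I_n}}) :
  two_coloring R B -> two_coloring B R.
Proof. by rewrite /two_coloring setUC disjoint_sym. Qed.

Lemma two_coloring_is_graph (R B : {set {set 'I_n}}) :
  two_coloring R B -> is_graph R.
Proof. by case/andP=> /eqP; rewrite /is_graph => <- _; apply: subsetUl. Qed.

Lemma hit_free_unbalanced (R B : {set {set 'I_n}}) : two_coloring R B ->
  hit_free m R \/ hit_free m B -> ~~ balanced_copy (path_graph m.*2) R B.
Proof.
move=> RB free_RB; apply/negP => /(balanced_pathP _ RB)[s [us ss hR]].
have := two_coloring_hits RB us; rewrite ss hR /= => hB.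
case: free_RB => /(_ s us); first by rewrite hR ltnn.
by lia.
Qed.

Lemma hit_free_H : hit_free m H.
Proof. by have [_ []] := iso_H gH; first exact: graph_iso_refl. Qed.

Lemma min_compl : minn #|H| #|complete 'I_n :\: H| = #|H|.
Proof.
by apply/minn_idPl; rewrite cardsD (setIidPr gH); lia.
Qed.

Lemma unbalanced_iso (R B : {set {set 'I_n}}) : two_coloring R B ->
    minn #|R| #|B| = #|H| ->
  ~~ balanced_copy (path_graph m.*2) R B <-> graph_iso R H \/ graph_iso B H.
Proof.
move=> RB min_RB.
have gR := two_coloring_is_graph RB.
have gB := two_coloring_is_graph (two_coloringC RB).
split=> [unb|].
  case: (balanced_or_hit_free hmn RB) => [bal|free_R|free_B].
  - by rewrite bal in unb.
  - by left; apply/(iso_H gR); split=> //; have := max_H gR free_R; lia.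
  - by right; apply/(iso_H gB); split=> //; have := max_H gB free_B; lia.
by case=> [/(iso_H gR)|/(iso_H gB)] [free _]; apply: hit_free_unbalanced; auto.
Qed.

Lemma bal_path : bal n (path_graph m.*2) = #|H|.
Proof.
rewrite /bal; case: ex_minnP => s fs min_s; apply/eqP; rewrite eqn_leq.
apply/andP; split.
  apply: min_s; apply/forallP => R; apply/forallP => B.
  apply/implyP => RB; apply/implyP; rewrite leq_min => /andP[lR lB].
  case: (balanced_or_hit_free hmn RB) => [//|free_R|free_B].
    by have := max_H (two_coloring_is_graph RB) free_R; lia.
  have := max_H (two_coloring_is_graph (two_coloringC RB)) free_B; lia.
rewrite leqNgt; apply/negP => lt_s.
have RB := two_coloring_setD gH.
have /forallP/(_ H)/forallP/(_ (complete _ :\: H)) := fs.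
rewrite RB min_compl lt_s /=; apply/negP; apply: hit_free_unbalanced => //.
by left; apply: hit_free_H.
Qed.

Lemma Bal_path (F : {set {set {set 'I_n}}}) :
  is_Bal (path_graph m.*2) F <-> only_graph H F.
Proof.
rewrite /is_Bal bal_path; split=> [[F_graph F_iff]|[F_neq0 F_iso]].
  split.
    have RB := two_coloring_setD gH.
    have /(F_iff _ _ RB min_compl)[H' H'F _] :
        ~~ balanced_copy (path_graph m.*2) H (complete 'I_n :\: H).
      by apply: hit_free_unbalanced => //; left; apply: hit_free_H.
    by apply/set0Pn; exists H'.
  move=> H' H'F; have [gH' cH'] := F_graph _ H'F.
  have RB := two_coloring_setD gH'.
  have minH' : minn #|H'| #|complete 'I_n :\: H'| = #|H|.
    by rewrite cardsD (setIidPr gH') cH'; apply/minn_idPl; lia.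
  have [_ unb] := F_iff _ _ RB minH'.
  have /(unbalanced_iso RB minH')[//|/graph_iso_card] :
      ~~ balanced_copy (path_graph m.*2) H' (complete 'I_n :\: H').
    by apply: unb; exists H' => //; left; apply: graph_iso_refl.
  (* The complement of [H'] has too many edges to be isomorphic to [H]. *)
  by rewrite cardsD (setIidPr gH') cH'; lia.
split=> [H' /F_iso iso_H'|R B RB min_RB].
  by rewrite (graph_iso_card iso_H') (graph_iso_is_graph iso_H' gH).
rewrite unbalanced_iso //; split=> [iso_RB|[H' /F_iso iso_H' [iso|iso]]].
- have /set0Pn[H' H'F] := F_neq0; exists H' => //.
  have iso_H' := graph_iso_sym (F_iso _ H'F).
  by case: iso_RB => iso; [left | right]; apply: graph_iso_trans iso iso_H'.
- by left; apply: graph_iso_trans iso iso_H'.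
- by right; apply: graph_iso_trans iso iso_H'.
Qed.
End Balance.

(** * Numerical evaluation and conclusion *)

Lemma double_bin2 n : 'C(n, 2).*2 = n * n.-1.
Proof.
rewrite bin2 -[RHS]odd_double_half oddM.
by case: n => //= n; case: (odd n).
Qed.

(** Doubling and moving the negative terms to the left removes binomials and truncated subtraction,
    so the identity can be cast to the rationals. *)
Lemma double_extremal m n : m.-1./2 <= n ->
  2 * extremal m n + m.-1./2 * (m.-1./2 + 1) =
  2 * (m.-1./2 * n) + 2 * ~~ odd m.
Proof.
rewrite /extremal; move: (m.-1)./2 => p pn.
have := double_bin2 p.
by case: (~~ odd m); case: p pn => [|p] pn /= hC; nia.
Qed.

Lemma bal_path_extremal n m : 0 < m -> m.*2 < n -> 6 * m <= n + 5 ->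
  bal n (path_graph m.*2) = extremal m n /\
  exists H : {set {set 'I_n}}, quasi_split m.-1./2 (~~ odd m) H /\
    forall F : {set {set {set 'I_n}}},
      is_Bal (path_graph m.*2) F <-> only_graph H F.
Proof.
move=> m_gt0 mn hn; set p := m.-1./2; set b := ~~ odd m.
have [|H qH] := @quasi_split_exists 'I_n p b; first by rewrite card_ord; lia.
have gH : is_graph H by case: qH => Y [].
have cH : #|H| = extremal m n.
  by case: qH => Y [cY _ _ ->]; rewrite (card_touching_setT cY) card_ord.
have free_H : hit_free m H by apply: quasi_split_hit_free.
have ext (E : {set {set 'I_n}}) : is_graph E -> hit_free m E ->
    #|E| <= #|H| /\ (#|E| = #|H| -> quasi_split p b E).
  by have := @hit_free_quasi_split 'I_n m E; rewrite card_ord cH; apply.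
have max_H (E : {set {set 'I_n}}) : is_graph E -> hit_free m E -> #|E| <= #|H|.
  by move=> gE /(ext _ gE)[].
have iso_H (E : {set {set 'I_n}}) : is_graph E ->
    (hit_free m E /\ #|E| = #|H|) <-> graph_iso E H.
  move=> gE; split=> [[free_E cE]|iso].
    by apply: quasi_split_iso qH; apply: (ext _ gE free_E).2.
  by rewrite (graph_iso_card iso); split=> //; apply: graph_iso_hit_free iso _.
have small_H : #|H|.*2 < #|complete 'I_n|.
  rewrite -ltn_double cH card_complete card_ord.
  have := @double_extremal m n; have := double_bin2 n.
  have pn : p <= n by lia.
  move=> -> /(_ pn); have Dm : m = p.*2.+1 + b by lia.
  move: (extremal m n) => e; rewrite -/p -/b.
  by case: b Dm {qH ext} => /= Dm; nia.
split; first by rewrite -cH; apply: bal_path.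
by exists H; split=> // F; apply: Bal_path.
Qed.

Import Order.TTheory GRing.Theory Num.Theory.
Local Open Scope ring_scope.

Theorem theorem3p3 (k n : nat) (hk : (2 <= k)%N) (k_even : ~~ odd k)
    (hn : 9 / 32 * k%:R ^+ 2 + 1 / 4 * k%:R + 1 <= n%:R :> rat) :
  (k = 2 %[mod 4] ->
     (bal n (path_graph k))%:R
       = (k%:R - 2) / 4 * n%:R - k%:R ^+ 2 / 32 + 1 / 8 :> rat /\
     exists H : {set {set 'I_n}},
       complete_split ((k - 2) %/ 4)%N (n - (k - 2) %/ 4)%N H /\
       forall F : {set {set {set 'I_n}}},
         is_Bal (path_graph k) F <-> only_graph H F) /\
  (k = 0 %[mod 4] ->
     (bal n (path_graph k))%:R
       = (k%:R - 4) / 4 * n%:R - k%:R ^+ 2 / 32 + k%:R / 8 + 1 :> rat /\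
     exists H : {set {set 'I_n}},
       complete_split_plus_edge ((k - 4) %/ 4)%N (n - (k - 4) %/ 4)%N H /\
       forall F : {set {set {set 'I_n}}},
         is_Bal (path_graph k) F <-> only_graph H F).
Proof.
have {}hn : (9 * k ^ 2 + 8 * k + 32 <= 32 * n)%N.
  by rewrite -(ler_nat rat) !(natrD, natrM, natrX); lra.
have [m Dk] : exists m, k = m.*2 by exists k./2; lia.
rewrite Dk in hk k_even hn *.
have {}hn : (9 * (m * m) + 4 * m + 8 <= 8 * n)%N.
  by move: hn; rewrite -muln2 expnMn -mulnn; lia.
have m_gt0 : (0 < m)%N by lia.
have mn : (m.*2 < n)%N by nia.
(* At [m = 2] and [m = 3] the integrality of [n] is needed: it gives [n >= 7] and [n >= 13], where
   the claim is an equality. Hence the separate small cases. *)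
have hn6 : (6 * m <= n + 5)%N by case: (m) hn => [|[|[|[|j]]]]; nia.
have [-> [H [qH Bal_H]]] := bal_path_extremal m_gt0 mn hn6.
have pn : (m.-1./2 <= n)%N by lia.
move: (extremal m n) (double_extremal pn) => e De.
have Dext := congr1 (fun i => i%:R : rat) De.
rewrite !(natrD, natrM) in Dext.
have pn' : (m.-1./2 <= #|'I_n|)%N by rewrite card_ord.
(* With [p = m.-1./2], the residue 2 means [m] odd and [k = 4p + 2], the residue 0 means [m] even
   and [k = 4p + 4]; in these terms both formulas reduce to [De]. *)
split=> m4; (split; last first).
- exists H; split=> //.
  have <- : m.-1./2 = ((m.*2 - 2) %/ 4)%N by lia.
  have := complete_splitE H pn'; rewrite card_ord => ->; move: qH.
  by have -> : odd m by lia.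
- have -> : m.*2 = (4 * m.-1./2 + 2)%N by lia.
  move: Dext; have -> /= : odd m by lia.
  by rewrite !(natrD, natrM); lra.
- exists H; split=> //.
  have <- : m.-1./2 = ((m.*2 - 4) %/ 4)%N by lia.
  have := complete_split_plus_edgeE H pn'; rewrite card_ord => ->; move: qH.
  by have -> : ~~ odd m by lia.
- have -> : m.*2 = (4 * m.-1./2 + 4)%N by lia.
  move: Dext; have -> /= : ~~ odd m by lia.
  by rewrite !(natrD, natrM); lra.
Qed.
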